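(* Let $X$ be a space and let $\mathscr{I}$ be an ideal in an upper semi-lattice $(\mathscr{L},\subseteq)$, where $\mathscr{L}\subseteq\mathscr{P}(X)$. Then $C^{\mathscr I}_{00}(X)$ is an ideal in $C_b(X)$.
   Context: A space is a topological space and $\mathscr{P}(X)$ is the power set of $X$. $C_b(X)$ is the algebra of continuous bounded $f:X\to\mathbb{R}$ with pointwise operations; $\mathrm{coz}(f)=X\setminus f^{-1}(0)$ and $\mathrm{supp}(f)=\mathrm{cl}_X\mathrm{coz}(f)$. An upper semi-lattice is a partially ordered set in which any two elements $A,B$ have a least upper bound $A\vee B$. For $\mathscr{L}\subseteq\mathscr{P}(X)$ ordered by inclusion, $A\vee B$ is computed in $\mathscr{L}$ and need not equal $A\cup B$. An ideal $\mathscr{I}$ in $(\mathscr{L},\subseteq)$ is a non-empty subset of $\mathscr{L}$ such that $A\vee B\in\mathscr{I}$ whenever $A,B\in\mathscr{I}$, and $T\in\mathscr{I}$ whenever $T\in\mathscr{L}$ and $T\subseteq A$ for some $A\in\mathscr{I}$. Elements of $\mathscr{I}$ are called null. A neighborhood of a set $A$ in $X$ is a set $U\subseteq X$ with $A\subseteq\mathrm{int}_XU$. $C^{\mathscr I}_{00}(X)=\{f\in C_b(X):\mathrm{supp}(f)\text{ has a null neighborhood in }X\}$. *)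

(* Defs.v *)
From HB Require Import structures.
From mathcomp Require Import all_boot all_order all_algebra.
From mathcomp Require Import all_classical all_reals all_analysis.

Set Implicit Arguments.
Unset Strict Implicit.
Unset Printing Implicit Defensive.

Import Order.TTheory GRing.Theory Num.Theory.
Import numFieldNormedType.Exports.

Local Open Scope classical_set_scope.
Local Open Scope ring_scope.

Section semilattice.
Variable X : Type.
Implicit Types (L I : set (set X)) (A B C T : set X).

(* The least upper bound is taken among the members of L only, so C may be
   strictly larger than A `|` B. *)
Definition is_join L A B C :=
  [/\ L C, A `<=` C, B `<=` C &
      forall D, L D -> A `<=` D -> B `<=` D -> C `<=` D].

Definition upper_semilattice L :=
  forall A B, L A -> L B -> exists C, is_join L A B C.

Definition semilattice_ideal L I :=
  [/\ I !=set0,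
      I `<=` L,
      forall A B C, I A -> I B -> is_join L A B C -> I C &
      forall A T, I A -> L T -> T `<=` A -> I T].

End semilattice.

Section bounded_continuous.
Variables (R : realType) (X : topologicalType).

Definition Cb_pred : {pred X -> R} :=
  mem [set f : X -> R | continuous f /\ bounded_fun f].

Record Cb := MkCb { Cb_fun :> X -> R; Cb_funP : Cb_fun \in Cb_pred }.

HB.instance Definition _ := [isSub of Cb for Cb_fun].
HB.instance Definition _ := [Choice of Cb by <:].

Lemma Cb_predP (f : X -> R) :
  f \in Cb_pred <-> continuous f /\ exists M, forall x, `|f x| <= M.
Proof.
rewrite inE /=; split=> -[cf]; last first.
  move=> [M fM]; split=> //; exists M; split; first exact: num_real.
  by move=> N MN x _ /=; exact: le_trans (fM x) (ltW MN).
by move=> [M [_ fM]]; split=> //; exists (M + 1) => x; apply: fM; rewrite ?ltrDl.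
Qed.

Lemma Cb_cst (c : R) : cst c \in Cb_pred.
Proof. by apply/Cb_predP; split; [move=> x; exact: cvg_cst|exists `|c|]. Qed.

Lemma Cb_subring : subring_closed Cb_pred.
Proof.
split; first exact: Cb_cst.
- move=> f g /Cb_predP[cf [M fM]] /Cb_predP[cg [N gN]]; apply/Cb_predP; split.
    by move=> x; apply: cvgB; [exact: cf|exact: cg].
  by exists (M + N) => x; apply: le_trans (ler_normB _ _) (lerD (fM x) (gN x)).
- move=> f g /Cb_predP[cf [M fM]] /Cb_predP[cg [N gN]]; apply/Cb_predP; split.
    by move=> x; apply: cvgM; [exact: cf|exact: cg].
  by exists (M * N) => x; rewrite normrM; apply: ler_pM.
Qed.

HB.instance Definition _ :=
  GRing.SubChoice_isSubComPzRing.Build (X -> R) Cb_pred Cb Cb_subring.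

Lemma Cb_subsemimod : GRing.subsemimod_closed Cb_pred.
Proof.
have [_ CB CM] := Cb_subring; split.
  split; first exact: Cb_cst.
  move=> f g fC gC; rewrite -[g]opprK; apply: (CB) => //.
  by rewrite -sub0r; apply: CB => //; exact: Cb_cst.
move=> a f fC; have -> : a *: f = cst a * f by apply/funext.
by apply: CM => //; exact: Cb_cst.
Qed.

HB.instance Definition _ :=
  GRing.SubZmodule_isSubLmodule.Build R (X -> R) Cb_pred Cb Cb_subsemimod.

(* MathComp's algebra and ideal structures require 1 != 0, which excludes an
   empty X, and its ring ideals are proper; here J may be all of Cb, as happens
   for C00 when X itself is null. One-sided absorption suffices, the product
   being commutative. *)
Definition Cb_ideal (J : set Cb) :=
  [/\ J 0,
      forall f g, J f -> J g -> J (f + g),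
      forall (a : R) f, J f -> J (a *: f) &
      forall h f, J f -> J (h * f)].

Definition coz (f : X -> R) : set X := ~` (f @^-1` [set 0]).

Definition supp (f : X -> R) : set X := closure (coz f).

(* A neighborhood is a set U with A `<=` U°, not necessarily open. *)
Definition has_null_nbhd (I : set (set X)) (A : set X) :=
  exists2 U, I U & A `<=` U°.

Definition C00 (I : set (set X)) : set Cb :=
  [set f : Cb | has_null_nbhd I (supp f)].

End bounded_continuous.

(* Main.v *)
Require Import Defs.
From mathcomp Require Import all_boot all_order all_algebra.
From mathcomp Require Import all_classical all_reals all_analysis.

(** The algebra operations create no new non-zeros: [coz (f + g)] lies in
    the union of [coz f] and [coz g], while [coz (a f)] and [coz (h f)] lie in
    [coz f].
    Closure is monotone and commutes with finite unions, so the same holds for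
    supports. It remains to see that the family of sets having a null
    neighborhood contains the empty set (an ideal is non-empty, and any null
    set is a neighborhood of the empty set), is closed under subsets, and is
    closed under binary unions. The last point is where the semi-lattice
    enters: if [U] and [V] are null neighborhoods of [A] and [B], then the join
    of [U] and [V] is null, and although it may be strictly larger than their
    union, it contains both, so its interior contains both interiors. *)

Import GRing.Theory.
Local Open Scope classical_set_scope.
Local Open Scope ring_scope.

Lemma subset_supp (R : realType) (X : topologicalType) (f g : X -> R) :
  coz g `<=` coz f -> supp g `<=` supp f.
Proof. exact: closureS. Qed.

Lemma coz_mulr_sub (R : realType) (X : topologicalType) (f h : X -> R) :
  coz (h * f) `<=` coz f.
Proof.
move=> x hfx fx0; apply: hfx.
by have /= := congr1 ( *%R (h x)) fx0; rewrite mulr0.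
Qed.

Lemma supp_add_sub (R : realType) (X : topologicalType) (f g : X -> R) :
  supp (f + g) `<=` supp f `|` supp g.
Proof.
rewrite /supp -closureU; apply: closureS => x fgx.
apply: contrapT => /not_orP[/contrapT fx0 /contrapT gx0]; apply: fgx.
by rewrite /preimage /= -[LHS]/(f x + g x) fx0 gx0 addr0.
Qed.

Lemma has_null_nbhd_subset (X : topologicalType) (I : set (set X))
    (A B : set X) :
  B `<=` A -> has_null_nbhd I A -> has_null_nbhd I B.
Proof. by move=> BA [U IU AU]; exists U => //; exact: subset_trans AU. Qed.

Lemma has_null_nbhd0 (X : topologicalType) (L I : set (set X)) :
  semilattice_ideal L I -> has_null_nbhd I set0.
Proof. by case=> -[U IU] _ _ _; exists U. Qed.

(** The witness is the join of the two null neighborhoods: it is null because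
    [I] is an ideal, and its interior contains both interiors by
    monotonicity. *)
Lemma has_null_nbhdU (X : topologicalType) (L I : set (set X))
    (A B : set X) : upper_semilattice L -> semilattice_ideal L I ->
  has_null_nbhd I A -> has_null_nbhd I B -> has_null_nbhd I (A `|` B).
Proof.
move=> joinL [_ IL IJ _] [U IU AU] [V IV BV].
have [W joinW] := joinL _ _ (IL _ IU) (IL _ IV).
have [_ UW VW _] := joinW.
exists W; first exact: IJ IU IV joinW.
rewrite subUset; split.
- exact: subset_trans AU (interiorS UW).
- exact: subset_trans BV (interiorS VW).
Qed.

Theorem theorem2p3 (R : realType) (X : topologicalType) (L I : set (set X))
    (hL : upper_semilattice L) (hI : semilattice_ideal L I) :
  Cb_ideal (C00 (R := R) I).
Proof.
split=> [|f g If Ig|a f If|h f If].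
- apply: has_null_nbhd_subset (has_null_nbhd0 _ _ _ hI).
  have coz0 : coz (Cb_fun (0 : Cb R X)) `<=` set0 by move=> x; apply.
  by apply: subset_trans (closureS coz0) _; rewrite closure0.
- apply: has_null_nbhd_subset (has_null_nbhdU _ _ _ _ _ hL hI If Ig).
  exact: supp_add_sub.
- apply: has_null_nbhd_subset If; apply: subset_supp.
  (* Pointwise, scaling by [a] is multiplication by the constant [a]. *)
  exact: (coz_mulr_sub _ _ f (cst a)).
- apply: has_null_nbhd_subset If; apply: subset_supp.
  exact: coz_mulr_sub.
Qed.
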